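(* Let $\ell$ and $m$ be positive integers with $\ell\le m-2$, let $G$ be an abelian group written additively, let $\mathbf{a}=(a_1,\dots,a_m)$ be a sequence of elements of $G$ with set of distinct terms $A$, and let $X=\{a\in A:\mu_{\mathbf{a}}(a)\ge2\}$. Assume $|X|\ge2$, and assume there exists a positive integer $t\ge2$, being the smallest positive integer with this property, such that $\sum_{i=1}^t\rho_{x_i}(\mathbf{a})\ge\ell+t$ for some $x_1,\dots,x_t\in X$. If \[ |\Sigma^{\ell}(\mathbf{a})|=\sum_{a\in A}\mu_{\mathbf{a}}(a)-\ell+1<\begin{cases}p(G)-1,&\ell=2,\\ p(G),&\ell\ge3,\end{cases} \] then $A$ is an arithmetic progression.
   Context: $p(G)$ is the order of the smallest nontrivial subgroup of $G$, or $\infty$ if none exists. $\Sigma^{\ell}(\mathbf{a})$ is the set of all sums $a_{i_1}+\cdots+a_{i_\ell}$ with $1\le i_1<\cdots<i_\ell\le m$. $\rho_a(\mathbf{a})=|\{i\in[1,m]:a_i=a\}|$ and $\mu_{\mathbf{a}}(a)=\min(\ell,\rho_a(\mathbf{a}))$. An arithmetic progression is a set $\{c+jd:j\in[0,k-1]\}$ with $d\ne0$. *)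

(* Defs.v *)
From mathcomp Require Import all_boot all_order all_algebra.
Set Implicit Arguments. Unset Strict Implicit. Unset Printing Implicit Defensive.
Import Order.TTheory GRing.Theory Num.Theory.
Local Open Scope ring_scope.

Definition is_subgroup (G : zmodType) (H : pred G) : Prop :=
  H 0 /\ forall x y, H x -> H y -> H (x - y).

(* [lt_pG G N] means  N < p(G), where p(G) is the order of the smallest
   nontrivial subgroup of G (infinite subgroups have order oo, and
   p(G) = oo if no nontrivial subgroup exists): every nontrivial finite
   subgroup H, enumerated without repetition by s, has order > N. *)
Definition lt_pG (G : zmodType) (N : nat) : Prop :=
  forall (H : pred G) (s : seq G),
    is_subgroup H -> uniq s -> (forall x, H x <-> x \in s) ->
    (exists x, H x /\ x != 0) -> (N < size s)%N.

Definition rho (G : zmodType) (a : seq G) (x : G) : nat := count_mem x a.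

Definition mu (G : zmodType) (l : nat) (a : seq G) (x : G) : nat :=
  minn l (rho a x).

Definition Sigma (G : zmodType) (l : nat) (a : seq G) : seq G :=
  undup [seq \sum_(i in J) a`_(nat_of_ord i)
        | J : {set 'I_(size a)} <- enum [set J : {set 'I_(size a)} | #|J| == l]].

Definition is_AP (G : zmodType) (A : seq G) : Prop :=
  exists (c d : G) (k : nat), d != 0 /\
    forall x, x \in A <-> exists j, (j < k)%N /\ x = c + d *+ j.

(* Main.v *)
(** The hypotheses say that every multiplicity is at most [l], so the size of
    [Sigma l a] is [m - l + 1], and that [m - #|A| >= l].  Taking one copy of
    each element of [A] off [a] leaves a sequence [a'] with at least [l] terms
    and multiplicities at most [l - 1].  Take a set [B] of at least two distinct
    terms off [a'] so that the remaining multiplicities are at most [l - 2], and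
    let [C] be the sums of [l - 2] of the remaining terms.  Then [A + B + C] is
    contained in [Sigma l a], and the Cauchy-Davenport bounds for [A + B + C]
    and [C] force [#|A + B| <= #|A| + #|B| - 1].  If [#|B| = 2], say
    [B = {x, y}], this makes [A] a progression of difference [y - x], since no
    set with fewer than p(G) elements has a period.  Otherwise one has
    [#|A + B| <= p(G) - 2], either because [#|C| >= 2] or because [l = 2], and
    Vosper's theorem applies.  Cauchy-Davenport and Vosper are proved in any
    abelian group by Dyson's e-transform. *)
Require Import Defs.
From mathcomp Require Import all_boot all_order all_algebra.
From mathcomp Require Import finmap zify.
Set Implicit Arguments. Unset Strict Implicit. Unset Printing Implicit Defensive.
Import Order.TTheory GRing.Theory Num.Theory.
Local Open Scope fset_scope.
Local Open Scope ring_scope.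

(** * Sumsets, and runs of fixed difference in a finite set *)

Definition sumset (G : zmodType) (A B : {fset G}) : {fset G} :=
  [fset x + y | x in A, y in B].

(** The last terms of the maximal runs of difference [d] in [A]; they count these runs as long as no
    run closes up into a cycle. *)
Definition ends (G : zmodType) (A : {fset G}) (d : G) : {fset G} :=
  [fset x in A | x + d \notin A].

Lemma sumsetP (G : zmodType) (A B : {fset G}) (z : G) :
  reflect (exists2 x, x \in A & exists2 y, y \in B & z = x + y)
          (z \in sumset A B).
Proof. exact: imfset2P. Qed.

Lemma mem_sumset (G : zmodType) (A B : {fset G}) (x y : G) :
  x \in A -> y \in B -> x + y \in sumset A B.
Proof. by move=> xA yB; apply/sumsetP; exists x => //; exists y. Qed.

Lemma sumsetC (G : zmodType) (A B : {fset G}) : sumset A B = sumset B A.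
Proof.
by apply/fsetP=> z; apply/sumsetP/sumsetP=> -[x xA [y yB ->]];
  exists y => //; exists x => //; rewrite addrC.
Qed.

Lemma sumsetA (G : zmodType) (A B C : {fset G}) :
  sumset A (sumset B C) = sumset (sumset A B) C.
Proof.
apply/fsetP=> z; apply/idP/idP.
  move=> /sumsetP[x xA [_ /sumsetP[y yB [t tC ->]] ->]].
  by rewrite addrA !mem_sumset.
move=> /sumsetP[_ /sumsetP[x xA [y yB ->]] [t tC ->]].
by rewrite -addrA !mem_sumset.
Qed.

Lemma card_translate (G : zmodType) (A : {fset G}) (y : G) :
  #|` [fset x + y | x in A]| = #|` A|.
Proof. by rewrite card_imfset //=; apply: addIr. Qed.

Lemma card_sumset_ge (G : zmodType) (A B : {fset G}) :
  B != fset0 -> (#|` A| <= #|` sumset A B|)%N.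
Proof.
case/fset0Pn=> y yB; rewrite -(card_translate A y).
by apply/fsubset_leq_card/fsubsetP=> _ /imfsetP[x /= xA ->]; apply: mem_sumset.
Qed.

Lemma sumset_neq0 (G : zmodType) (A B : {fset G}) :
  A != fset0 -> B != fset0 -> sumset A B != fset0.
Proof.
by case/fset0Pn=> x xA /fset0Pn[y yB]; apply/fset0Pn; exists (x + y); apply: mem_sumset.
Qed.

(* Otherwise the stabilizer of [A] is a nontrivial subgroup of order at most [#|` A|]. *)
Lemma ends_neq0 (G : zmodType) (N : nat) (A : {fset G}) (d : G) :
  lt_pG G N -> A != fset0 -> (#|` A| <= N)%N -> d != 0 -> ends A d != fset0.
Proof.
move=> hN /fset0Pn[a aA] leN d0; apply/negP=> /eqP ends0.
pose H (x : G) := [forall y : A, fsval y + x \in A].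
have HP x : reflect (forall y, y \in A -> y + x \in A) (H x).
  apply: (iffP forallP) => [h y yA|h y]; first exact: (h [` yA]).
  by apply: h; apply: fsvalP.
have Hd : H d.
  apply/HP=> y yA; apply: contraT => ydA.
  by have : y \in ends A d by [rewrite !inE yA]; rewrite ends0 inE.
have subgH : is_subgroup H.
  split=> [|x y /HP hx /HP hy]; first by apply/HP=> y; rewrite addr0.
  apply/HP=> z zA.
  have /eqP eqA : [fset t + y | t in A] == A.
    rewrite eqEfcard card_translate leqnn andbT.
    by apply/fsubsetP=> _ /imfsetP[t /= tA ->]; apply: hy.
  have /imfsetP[t /= tA ezx] : z + x \in [fset t + y | t in A] by rewrite eqA hx.
  by rewrite addrA ezx addrK.
pose s := [seq x <- [fset x - a | x in A] | H x].
have /(_ s) : forall s, _ := hN H.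
have us : uniq s by rewrite filter_uniq ?fset_uniq.
have sE x : H x <-> x \in s.
  rewrite mem_filter; split=> [Hx|/andP[]//]; rewrite Hx.
  have /HP/(_ a aA) axA := Hx.
  by apply/imfsetP; exists (a + x); rewrite //= addrC addKr.
move=> /(_ subgH us sE (ex_intro _ d (conj Hd d0))).
apply/negP; rewrite -leqNgt; apply: leq_trans leN.
by rewrite -(card_translate A (- a)) size_filter count_size.
Qed.

(** A point [z + y] of [A + y] already lies in [A + x] exactly when [z + (y - x)] is in [A], so only
    the ends contribute new sums. *)
Lemma card_ends (G : zmodType) (A : {fset G}) (x y : G) :
  #|` sumset A [fset x; y]| = (#|` A| + #|` ends A (y - x)|)%N.
Proof.
rewrite -(card_translate A x) -(card_translate (ends A _) y) -cardfsUI.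
have -> : [fset z + x | z in A] `&` [fset z + y | z in ends A (y - x)] = fset0.
  apply/eqP; apply: contraT => /fset0Pn[_ /fsetIP[/imfsetP[z /= zA ->]]].
  case/imfsetP=> t /=; rewrite !inE /= => /andP[tA tN] ezt.
  by rewrite addrA -ezt addrK zA in tN.
rewrite cardfs0 addn0; congr #|` _|; apply/fsetP=> z; apply/sumsetP/fsetUP.
  move=> [t tA [u]]; rewrite !inE => /orP[/eqP->|/eqP->] ->.
    by left; apply/imfsetP; exists t.
  have [tN|tN] := boolP (t + (y - x) \in A); last first.
    by right; apply/imfsetP; exists t; rewrite //= !inE tA.
  by left; apply/imfsetP; exists (t + (y - x)); rewrite //= addrA subrK.
move=> [/imfsetP[t /= tA ->]|/imfsetP[t /=]].
  by exists t => //; exists x; rewrite ?inE ?eqxx.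
by rewrite !inE /= => /andP[tA _] ->; exists t => //; exists y; rewrite ?inE ?eqxx ?orbT.
Qed.

(** Remove a [c] in [A] with [c - d] outside [A]. This creates no new end, so by induction the rest
    is a progression, and [c] fits in front of it. *)
Lemma AP_of_ends (G : zmodType) (N : nat) (A : {fset G}) (d : G) :
  lt_pG G N -> (#|` A| <= N)%N -> A != fset0 -> d != 0 ->
  (#|` ends A d| <= 1)%N ->
  exists c k, forall x, x \in A <-> exists j, (j < k)%N /\ x = c + d *+ j.
Proof.
move=> hN + + d0; have [n] := ubnP #|` A|; elim: n A => // n IH A ltn leN A0 ends1.
have /fset0Pn[c] : ends A (- d) != fset0 by rewrite (ends_neq0 hN) ?oppr_eq0.
rewrite !inE /= => /andP[cA cdA]; have := cardfsD1 c A; rewrite cA => cardA.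
have [A1|A1] := eqVneq (A `\ c) fset0.
  exists c, 1%N => x; rewrite -(fsetD1K cA) A1 fsetU0 inE; split=> [/eqP->|].
    by exists 0%N; rewrite addr0.
  by move=> [[|j] [// _ ->]]; rewrite addr0.
have endsD1 : ends (A `\ c) d `<=` ends A d.
  apply/fsubsetP=> x; rewrite !inE /= => /andP[/andP[xc xA]].
  rewrite xA negb_and negbK => /orP[/eqP xdc|//].
  by rewrite -xdc addrK xA in cdA.
have endsD0 : ends (A `\ c) d != fset0 by apply: (ends_neq0 hN) => //; lia.
(* Otherwise [c] is the only end of [A], which leaves none for the nonempty rest. *)
have cd : c + d \in A.
  apply: contraT => cdN; have /fset0Pn[x xe] := endsD0.
  have /eqP/cardfs1P[y ey] : #|` ends A d| = 1%N.
    by have := fsubset_leq_card endsD1; move: endsD0; rewrite -cardfs_gt0; lia.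
  have : c \in ends A d by rewrite !inE /= cA.
  rewrite ey inE => /eqP cy; move/fsubsetP: endsD1 => /(_ x xe).
  by rewrite ey inE -cy => /eqP xc; move: xe; rewrite xc !inE eqxx.
have [||//||c' [k AE]] := IH (A `\ c); [lia|lia| |].
  exact: leq_trans (fsubset_leq_card endsD1) ends1.
have cc : c + d \in A `\ c.
  by rewrite !inE cd andbT; apply: contraNneq d0 => /(canRL (addKr _)) ->; rewrite addNr.
(* If [c + d] came later in the progression, its predecessor [c] would belong to the rest. *)
have ec : c + d = c'.
  have /AE[[|j] [jk]] := cc; first by rewrite addr0.
  rewrite mulrSr addrA => /addIr cE.
  have /AE : exists i, (i < k)%N /\ c = c' + d *+ i by exists j; split=> //; lia.
  by rewrite !inE eqxx.
exists c, k.+1 => x; rewrite -(fsetD1K cA) in_fset1U; split.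
  case/orP=> [/eqP->|/AE[j [jk ->]]]; first by exists 0%N; rewrite addr0.
  by exists j.+1; split=> //; rewrite -ec mulrS addrA.
move=> [[|j] [jk ->]]; first by rewrite addr0 eqxx.
apply/orP; right; apply/AE; exists j; split=> //.
by rewrite -ec mulrS addrA.
Qed.

(** * Dyson's e-transform and the Cauchy-Davenport bound *)

Definition dyson_l (G : zmodType) (A B : {fset G}) (e : G) : {fset G} :=
  A `|` [fset y + e | y in B].

Definition dyson_r (G : zmodType) (A B : {fset G}) (e : G) : {fset G} :=
  [fset y in B | y + e \in A].

(** Translated by [e], [dyson_r] becomes the intersection of [A] and [B + e], whose union is
    [dyson_l]. *)
Lemma card_dyson (G : zmodType) (A B : {fset G}) (e : G) :
  (#|` dyson_l A B e| + #|` dyson_r A B e| = #|` A| + #|` B|)%N.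
Proof.
rewrite -(card_translate B e) -(cardfsUI A); congr addn.
rewrite -(card_translate (dyson_r _ _ _) e); congr #|` _|; apply/fsetP=> z.
apply/imfsetP/fsetIP => /= [[y]|[zA /imfsetP[y /= yB ez]]].
  by rewrite !inE /= => /andP[yB yA] ->; split=> //; apply/imfsetP; exists y.
by exists y => //; rewrite !inE yB /= -ez.
Qed.

Lemma sumset_dyson (G : zmodType) (A B : {fset G}) (e : G) :
  sumset (dyson_l A B e) (dyson_r A B e) `<=` sumset A B.
Proof.
apply/fsubsetP=> _ /sumsetP[x + [y + ->]].
rewrite !inE /= => /orP[xA|/imfsetP[t /= tB ->]] /andP[yB yA].
  exact: mem_sumset.
by rewrite -addrA addrC (addrC e) mem_sumset.
Qed.

(** Induction on [B]. For [b1 != b2] in [B], an end [x] of [A] for the difference [b2 - b1] gives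
    [e = x - b1], whose transform keeps [b1] in [B] and drops [b2]. *)
Lemma cauchy_davenport (G : zmodType) (N : nat) (A B : {fset G}) :
  lt_pG G N -> A != fset0 -> B != fset0 -> (#|` sumset A B| <= N)%N ->
  (#|` A| + #|` B| <= #|` sumset A B|.+1)%N.
Proof.
move=> hN; have [n] := ubnP #|` B|; elim: n A B => // n IH A B ltn A0 B0 leN.
have [|B2] := leqP #|` B| 1; first by have := card_sumset_ge A B0; lia.
have /fset0Pn[b1 b1B] := B0.
have /fset0Pn[b2] : B `\ b1 != fset0.
  by rewrite -cardfs_gt0; move: (cardfsD1 b1 B); rewrite b1B; lia.
rewrite !inE => /andP[b21 b2B].
have /fset0Pn[x] : ends A (b2 - b1) != fset0.
  apply: (ends_neq0 hN) => //; last by rewrite subr_eq0.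
  exact: leq_trans (card_sumset_ge A B0) leN.
rewrite !inE /= => /andP[xA xbA].
pose e := x - b1.
have b1r : b1 \in dyson_r A B e by rewrite !inE /= b1B /e addrC subrK.
have ltr : (#|` dyson_r A B e| < #|` B|)%N.
  apply/fproper_ltn_card; rewrite fproperE; apply/andP; split.
    by apply/fsubsetP=> z; rewrite !inE => /andP[].
  apply/negP=> /fsubsetP/(_ b2 b2B); rewrite !inE /= b2B /e addrCA.
  exact/negP.
have /fsubset_leq_card lesum := sumset_dyson A B e.
rewrite -(card_dyson A B e); apply: leq_trans (IH _ _ _ _ _ _) _ => //.
- by lia.
- by have /fset0Pn[a aA] := A0; apply/fset0Pn; exists a; rewrite inE aA.
- by apply/fset0Pn; exists b1.
- exact: leq_trans leN.
Qed.


(** * Vosper's theorem *)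

Lemma cardfs2P (K : choiceType) (B : {fset K}) :
  #|` B| = 2%N -> exists x y, x != y /\ B = [fset x; y].
Proof.
move=> B2; have /fset0Pn[x xB] : B != fset0 by rewrite -cardfs_gt0 B2.
have := cardfsD1 x B; rewrite B2 xB => -[/esym/eqP/cardfs1P[y By]].
have : y \in B `\ x by rewrite By inE.
rewrite !inE eq_sym => /andP[xy yB]; exists x, y; split=> //.
by rewrite -(fsetD1K xB) By.
Qed.

(* Induction on [#|` B|] via the e-transform [e = a - b0].  If no [a] in [A] gives
   an intersection strictly between [{b0}] and [B], put [a] in [E] when the
   intersection is [B] and in [F] when it is [{b0}]: then [A + b0] and
   [F + (B \ b0)] are disjoint in [A + B], and [E + B] lies in [A + b0], which
   bound [#|` F|] above by 1 and [#|` E|] by [#|` A| - #|` B| + 1]. *)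
Lemma vosper_ends (G : zmodType) (N : nat) (A B : {fset G}) :
  lt_pG G N -> (1 < #|` A|)%N -> (1 < #|` B|)%N ->
  (#|` sumset A B| <= N)%N -> (#|` sumset A B| < #|` A| + #|` B|)%N ->
  exists2 d, d != 0 & (#|` ends (sumset A B) d| <= 1)%N.
Proof.
move=> hN; have [n] := ubnP #|` B|; elim: n A B => // n IH A B ltn A1 B1 leN ltAB.
have A0 : A != fset0 by rewrite -cardfs_gt0 ltnW.
have B0 : B != fset0 by rewrite -cardfs_gt0 ltnW.
have [/eqP B2|B2] := boolP (#|` B| == 2%N).
  have [x [y [xy eB]]] := cardfs2P B2; subst B.
  exists (y - x); first by rewrite subr_eq0 eq_sym.
  move: ltAB; rewrite card_ends cardfs2 xy => ltAB.
  have : (#|` ends A (y - x)| <= 1)%N by lia.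
  (* Every end of [A + {x, y}] is an end of [A] translated by [y]. *)
  apply: leq_trans; rewrite -(card_translate (ends A (y - x)) y).
  apply/fsubset_leq_card/fsubsetP=> z; rewrite !inE /= => /andP[/sumsetP[a aA [u]]].
  rewrite !inE => /orP[]/eqP-> -> nin.
    by rewrite -addrA (addrC x) subrK mem_sumset ?inE ?eqxx ?orbT in nin.
  apply/imfsetP; exists a; rewrite //= !inE aA; apply: contra nin => adA.
  by rewrite -addrA (addrC y) addrA mem_sumset ?inE ?eqxx ?orbT.
have /fset0Pn[b0 b0B] := B0.
have [/hasP[a aA /andP[r1 rB]]|/hasPn noa] := boolP (has
    (fun a => (1 < #|` dyson_r A B (a - b0)|)
           && (#|` dyson_r A B (a - b0)| < #|` B|))%N A).
  have /fsubset_leq_card lesum := sumset_dyson A B (a - b0).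
  have cardd := card_dyson A B (a - b0).
  set A' := dyson_l _ _ _ in lesum cardd; set B' := dyson_r _ _ _ in r1 rB lesum cardd.
  have A'0 : A' != fset0 by apply/fset0Pn; exists a; rewrite inE aA.
  have B'0 : B' != fset0 by rewrite -cardfs_gt0 ltnW.
  have cd := cauchy_davenport hN A'0 B'0 (leq_trans lesum leN).
  (* The transform keeps the total cardinality, so Cauchy-Davenport leaves no room for a smaller
     sumset. *)
  have <- : sumset A' B' = sumset A B.
    by apply/eqP; rewrite eqEfcard sumset_dyson; lia.
  by apply: IH => //; lia.
pose E := [fset a in A | B `<=` dyson_r A B (a - b0)].
have EA : E `<=` A by apply/fsubsetP=> z; rewrite !inE => /andP[].
pose B' := B `\ b0; have cardB' := cardfsD1 b0 B; rewrite b0B -/B' in cardB'.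
have B'0 : B' != fset0 by rewrite -cardfs_gt0; lia.
pose F := A `\` E; have cardF := cardfsDS EA; rewrite -/F in cardF.
have FB' a b : a \in F -> b \in B' -> a - b0 + b \notin A.
  rewrite !inE negb_and => /andP[+ aA] /andP[bb0 bB]; rewrite aA /= => nsub.
  have := noa a aA; rewrite negb_and -!leqNgt.
  have rB : dyson_r A B (a - b0) `<=` B by apply/fsubsetP=> z; rewrite !inE => /andP[].
  case/orP=> [le1|leB]; last first.
    have /eqP eqB : dyson_r A B (a - b0) == B by rewrite eqEfcard rB.
    by rewrite eqB fsubset_refl in nsub.
  apply: contraL le1 => abA; rewrite -ltnNge.
  have <- : #|` [fset b0; b]| = 2%N by rewrite cardfs2 eq_sym bb0.
  apply/fsubset_leq_card/fsubsetP=> z; rewrite !inE => /orP[]/eqP->.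
    by rewrite b0B addrC subrK.
  by rewrite bB addrC.
have dis : [fset x + b0 | x in A] `&` sumset F B' = fset0.
  apply/eqP; apply: contraT => /fset0Pn[_ /fsetIP[/imfsetP[z /= zA ->]]].
  move=> /sumsetP[a aF [b bB' ezab]]; move: (FB' a b aF bB').
  by rewrite addrAC -ezab addrK zA.
have sub : [fset x + b0 | x in A] `|` sumset F B' `<=` sumset A B.
  apply/fsubsetP=> z /fsetUP[/imfsetP[x /= xA ->]|/sumsetP[x xF [y yB ->]]].
    exact: mem_sumset.
  by apply: mem_sumset; [move: xF|move: yB]; rewrite !inE => /andP[].
have cardFB' : (#|` A| + #|` sumset F B'| <= #|` sumset A B|)%N.
  rewrite -(card_translate A b0) -cardfsUI dis cardfs0 addn0.
  exact: fsubset_leq_card.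
have Fle1 : (#|` F| <= 1)%N.
  have [->|F0] := eqVneq F fset0; first by rewrite cardfs0.
  have leFB : (#|` sumset F B'| <= N)%N by lia.
  have := cauchy_davenport hN F0 B'0 leFB; lia.
have [E0|E0] := eqVneq E fset0; first by move: cardF; rewrite E0 cardfs0; lia.
have leEB : (#|` sumset E B| <= #|` A|)%N.
  rewrite -(card_translate A b0); apply/fsubset_leq_card/fsubsetP.
  move=> _ /sumsetP[a aE [b bB ->]]; apply/imfsetP; exists (a - b0 + b) => /=.
    move: aE; rewrite !inE => /andP[aA /fsubsetP/(_ b bB)].
    by rewrite !inE addrC => /andP[].
  by rewrite addrAC subrK.
have leAN := leq_trans (card_sumset_ge A B0) leN.
have := cauchy_davenport hN E0 B0 (leq_trans leEB leAN).
have := fsubset_leq_card EA; lia.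
Qed.

Lemma AP_of_pair (G : zmodType) (N : nat) (A B : {fset G}) :
  lt_pG G N -> A != fset0 -> #|` B| = 2%N -> (#|` A| <= N)%N ->
  (#|` sumset A B| <= #|` A|.+1)%N ->
  exists c d k, d != 0 /\ forall x, x \in A <-> exists j, (j < k)%N /\ x = c + d *+ j.
Proof.
move=> hN A0 /cardfs2P[x [y [xy ->]]] leN; rewrite card_ends => le1.
have d0 : y - x != 0 by rewrite subr_eq0 eq_sym.
have [|c [k ck]] := AP_of_ends hN leN A0 d0; first by lia.
by exists c, (y - x), k.
Qed.

(** The bound by [N] is strict to leave room for the one element that adding [{0, d}] may
    contribute. *)
Lemma vosper (G : zmodType) (N : nat) (A B : {fset G}) :
  lt_pG G N -> (1 < #|` A|)%N -> (1 < #|` B|)%N ->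
  (#|` sumset A B| < N)%N -> (#|` sumset A B| < #|` A| + #|` B|)%N ->
  exists c d k, d != 0 /\ forall x, x \in A <-> exists j, (j < k)%N /\ x = c + d *+ j.
Proof.
move=> hN A1 B1 ltN ltAB.
have A0 : A != fset0 by rewrite -cardfs_gt0 ltnW.
have B0 : B != fset0 by rewrite -cardfs_gt0 ltnW.
have [d d0 ends1] := vosper_ends hN A1 B1 (ltnW ltN) ltAB.
(* [(A + {0, d}) + B] has at most [#|A + B| + 1] elements, so Cauchy-Davenport
   bounds [A + {0, d}]. *)
have D2 : #|` [fset 0; d]| = 2%N by rewrite cardfs2 eq_sym d0.
have leAN : (#|` A| <= N)%N := leq_trans (card_sumset_ge A B0) (ltnW ltN).
apply: (AP_of_pair hN A0 D2 leAN).
have eS : sumset (sumset A [fset 0; d]) B = sumset (sumset A B) [fset 0; d].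
  by rewrite -!sumsetA (sumsetC B).
have := cauchy_davenport hN (A := sumset A [fset 0; d]) _ B0.
rewrite eS (card_ends (sumset A B)) subr0 => cd.
have AD0 : sumset A [fset 0; d] != fset0.
  by apply: sumset_neq0 => //; rewrite -cardfs_gt0 D2.
by move/(_ AD0): cd => /(_ ltac:(lia)); lia.
Qed.

(** * Sums of subsequences and splitting sequences into sets *)

Lemma mem_Sigma (G : zmodType) (l : nat) (a s : seq G) :
  size s = l -> (forall x, count_mem x s <= count_mem x a)%N ->
  \sum_(x <- s) x \in Sigma l a.
Proof.
move=> sl /count_subseqP[s' /subseqP[m sm es'] pss'].
rewrite mem_undup (perm_big _ pss') es'; rewrite es' in pss'.
apply/mapP; exists [set i : 'I_(size a) | nth false m i].
  rewrite mem_enum inE -sl (perm_size pss') -[size (mask m a)]sum1_size big_mask -sum1_card.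
  by apply/eqP/eq_bigl => i; rewrite !inE andbT.
by rewrite big_mask; apply: eq_big => i; rewrite ?inE ?andbT // (tnth_nth 0).
Qed.

Lemma sum_count_undup (T : eqType) (b : seq T) :
  (\sum_(x <- undup b) count_mem x b = size b)%N.
Proof.
rewrite -[RHS](perm_size (perm_count_undup b)) size_flatten sumnE !big_map.
by apply: eq_bigr => x _; rewrite size_nseq.
Qed.

Lemma perm_cat_uniq_sub (T : eqType) (s b : seq T) :
  uniq s -> {subset s <= b} -> exists b', perm_eq b (s ++ b').
Proof.
elim: s b => [|x s IH] b /=; first by exists b.
case/andP=> xs us sb; have /perm_to_rem pb := sb x (mem_head x s).
have [y ys|b' pb'] := IH (rem x b) us.
  have /(_ y) := perm_mem pb; rewrite sb ?inE ?ys ?orbT //.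
  by case: eqVneq => // eyx; rewrite -eyx ys in xs.
by exists b'; apply: (perm_trans pb); rewrite perm_cons.
Qed.

(** [B] takes every term of maximal multiplicity [k.+1], padded up to [r] terms if there are too
    few. Without padding, each of its elements accounts for [k.+1] terms of [b]. *)
Lemma extract_fset (T : choiceType) (k r : nat) (b : seq T) :
  (forall x, count_mem x b <= k.+1)%N -> (r <= size (undup b))%N ->
  exists (B : {fset T}) (b' : seq T),
    [/\ perm_eq b (B ++ b'), (forall x, count_mem x b' <= k)%N,
        (r <= #|` B|)%N & (#|` B| = r \/ #|` B| * k.+1 <= size b)%N].
Proof.
move=> bk rb; pose P x := count_mem x b == k.+1.
pose H := filter P (undup b); pose L := filter (predC P) (undup b).
have pHL : perm_eq (H ++ L) (undup b) by apply/permPl/perm_filterC.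
pose s := take (maxn r (size H)) (H ++ L).
have ss : size s = maxn r (size H).
  by rewrite size_takel // geq_max (perm_size pHL) rb size_filter count_size.
have us : uniq s by rewrite take_uniq // (perm_uniq pHL) undup_uniq.
have sb : {subset s <= b} by move=> x /mem_take; rewrite (perm_mem pHL) mem_undup.
have Hs x : x \in H -> x \in s.
  by rewrite /s take_cat ltnNge leq_maxr /= mem_cat => ->.
pose B := [fset x in s].
have pB : perm_eq B s by apply: uniq_perm => // x; rewrite inE.
have uB : uniq B := fset_uniq B.
have [b' pb] : exists b', perm_eq b (B ++ b').
  by apply: perm_cat_uniq_sub => // x; rewrite inE => /sb.
have cB : #|` B| = maxn r (size H) by rewrite (perm_size pB).
exists B, b'; split=> //; last 2 first.
- by rewrite cB leq_maxl.
- rewrite cB; have [|rH] := leqP (size H) r; first by left; lia.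
  right; rewrite -(sum_count_undup b).
  rewrite -(perm_big _ pHL) big_cat /= -sum1_size big_distrl /=.
  apply: leq_trans (leq_addr _ _); rewrite leq_eqVlt; apply/orP; left.
  by apply/eqP/eq_big_seq => x; rewrite mem_filter => /andP[/eqP-> _]; rewrite mul1n.
move=> x; have := bk x.
have /(_ (pred1 x)) cx := permP pb; rewrite count_cat (count_uniq_mem x uB) in cx.
have [xB|xB] := boolP (x \in B); first by rewrite cx xB add1n ltnS.
rewrite leq_eqVlt ltnS => /orP[xk|]; last by rewrite cx; lia.
have : x \in B; last by rewrite (negbTE xB).
by rewrite inE Hs // mem_filter /P xk mem_undup -has_pred1 has_count (eqP xk).
Qed.

(** Extracting sets repeatedly splits [b] into [k] nonempty sets; [C] is their sumset, bounded below
    by Cauchy-Davenport. *)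
Lemma card_subsequence_sums (G : zmodType) (N k : nat) (b : seq G) :
  lt_pG G N -> (forall x, count_mem x b <= k)%N -> (k <= size b)%N ->
  exists C : {fset G}, [/\ C != fset0,
    (#|` C| <= N -> size b < #|` C| + k)%N &
    forall c, c \in C -> exists s, [/\ size s = k,
      (forall x, count_mem x s <= count_mem x b)%N & c = \sum_(x <- s) x]].
Proof.
move=> hN; elim: k b => [|k IH] b bk kb.
  exists [fset 0]; split=> [||c].
  - by apply/fset0Pn; exists 0; rewrite inE.
  - case: b bk kb => [|x b bk] //; first by rewrite cardfs1.
    by have := bk x; rewrite /= eqxx.
  - by rewrite inE => /eqP->; exists [::]; rewrite big_nil.
have [|B [b' [pb b'k B1 cB]]] := extract_fset (r := 1) bk.
  by case: b kb {bk} => // x b _; rewrite lt0n size_eq0; apply/eqP => /undup_nil.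
have sb : size b = (#|` B| + size (b' : seq G))%N by rewrite (perm_size pb) size_cat.
have kb' : (k <= size b')%N.
  case: cB => [cB|]; first by move: kb; rewrite sb cB.
  rewrite mulnS sb leq_add2l; apply: leq_trans.
  by rewrite leq_pmull.
have [C [C0 cardC CE]] := IH b' b'k kb'.
have B0 : B != fset0 by rewrite -cardfs_gt0.
exists (sumset B C); split=> [|leN|c].
- exact: sumset_neq0.
- have cd := cauchy_davenport hN B0 C0 leN.
  have leCN : (#|` C| <= N)%N.
    by apply: leq_trans leN; rewrite sumsetC card_sumset_ge.
  rewrite sb; have := cardC leCN; lia.
- move=> /sumsetP[x xB [_ /CE[s [ss cs ->]] ->]].
  exists (x :: s); rewrite big_cons /= ss; split=> // y.
  have /(_ (pred1 y)) -> := permP pb; rewrite count_cat leq_add //.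
  rewrite count_uniq_mem //; by case: eqVneq => // <-; rewrite xB.
Qed.

(** * Splitting the sequence into [A], [B] and a remainder *)

Theorem theorem6p9 (G : zmodType) (l : nat) (a : seq G) :
  (0 < l)%N -> (0 < size a)%N -> (l <= size a - 2)%N ->
  let A := undup a in
  let X := [seq x <- A | (2 <= mu l a x)%N] in
  (2 <= size X)%N ->
  let P := fun t : nat => exists xs : seq G,
      [/\ size xs = t, uniq xs, all (mem X) xs &
          (l + t <= \sum_(x <- xs) rho a x)%N] in
  (exists t : nat, [/\ (2 <= t)%N, P t &
      forall t' : nat, (0 < t')%N -> (t' < t)%N -> ~ P t']) ->
  ((size (Sigma l a))%:Z = (\sum_(x <- A) mu l a x)%:Z - l%:Z + 1) ->
  (if l == 2%N then lt_pG G (size (Sigma l a)).+1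
               else lt_pG G (size (Sigma l a))) ->
  is_AP A.
Proof.
move=> _ _ lea A X X2 P [t [t2 [xs [sxs uxs /allP xsX Pxs]] tmin]] eqS hp.
have uX : uniq X by rewrite filter_uniq ?undup_uniq.
have [k ek] : exists k, l = k.+2.
  have [x] : exists x, x \in X by case: (X) X2 => // x *; exists x; rewrite mem_head.
  by rewrite mem_filter => /andP[]; case: (l) => [|[|k]]; rewrite /mu; [lia|lia|exists k].
(* A larger multiplicity would make [P 1] true, against the minimality of [t >= 2]. *)
have mult x : (count_mem x a <= l)%N.
  rewrite leqNgt; apply/negP=> lx; apply: (tmin 1%N) => //; exists [:: x].
  rewrite big_seq1 addn1 /= andbT; split=> //.
  rewrite mem_filter /mu /rho mem_undup -has_pred1 has_count.
  by apply/andP; split; lia.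
have sumA : (\sum_(x <- A) mu l a x = size a)%N.
  rewrite -sum_count_undup; apply: eq_bigr => x _; exact/minn_idPr/mult.
have [a' pa] : exists a' : seq G, perm_eq a (A ++ a').
  by apply: perm_cat_uniq_sub; [apply: undup_uniq | move=> x; rewrite mem_undup].
have cnt x : count_mem x a = ((x \in A) + count_mem x a')%N.
  by have /(_ (pred1 x)) -> := permP pa; rewrite count_cat count_uniq_mem ?undup_uniq.
have sza : size a = (size A + size a')%N by rewrite (perm_size pa) size_cat.
have Xa' x : x \in X -> x \in a'.
  rewrite mem_filter leq_min /rho cnt => /andP[/andP[_ rx] xA].
  by rewrite xA in rx; rewrite -has_pred1 has_count.
have a'2 : (1 < size (undup a'))%N.
  apply: leq_trans X2 _; apply: uniq_leq_size => // x /Xa'.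
  by rewrite mem_undup.
(* Each of the [t] terms of [xs] loses one copy, so at least [l + t - t] copies remain. *)
have la' : (l <= size a')%N.
  have sumxs : (\sum_(x <- xs) count_mem x a' <= size a')%N.
    have [r pr] : exists r, perm_eq (undup a') (xs ++ r).
      by apply: perm_cat_uniq_sub => // x /xsX/Xa'; rewrite mem_undup.
    by rewrite -sum_count_undup (perm_big _ pr) big_cat leq_addr.
  apply: leq_trans sumxs; rewrite -(leq_add2l t) addnC; apply: leq_trans Pxs _.
  rewrite -sxs -sum1_size -big_split /=.
  by apply: leq_sum => x _; rewrite /rho cnt leq_add2r; case: (_ \in _).
have mult' x : (count_mem x a' <= k.+1)%N.
  have := mult x; have := cnt x; rewrite mem_undup -has_pred1 has_count; lia.
have [B [a'' [pa' mult'' B2 cB]]] := extract_fset mult' a'2.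
have sza' : size a' = (#|` B| + size (a'' : seq G))%N by rewrite (perm_size pa') size_cat.
have {}cB : (#|` B| = 2 \/ 2 * k <= size (a'' : seq G))%N.
  case: cB => [->|]; first by left.
  rewrite mulnS sza' leq_add2l => h; right.
  by apply: leq_trans h; rewrite leq_mul2r B2 orbT.
have ka'' : (k <= size (a'' : seq G))%N by lia.
pose N := size (Sigma l a).
have eN : (N + k.+1 = size A + (#|` B| + size (a'' : seq G)))%N.
  have : (N + l)%:Z = (size a + 1)%:Z by rewrite !PoszD eqS sumA addrAC subrK.
  by case; rewrite sza sza' ek; lia.
have hN : lt_pG G N.
  move: hp; case: ifP => _ h //; move=> H s h1 h2 h3 h4.
  exact: ltnW (h H s h1 h2 h3 h4).
have [C [C0 cardC CE]] := card_subsequence_sums hN mult'' ka''.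
pose AF := [fset x in A].
have AFE x : (x \in AF) = (x \in A) by rewrite inE.
have cardAF : #|` AF| = size A.
  by apply: perm_size; apply: uniq_perm; rewrite ?undup_uniq.
have subS : {subset sumset (sumset AF B) C <= Sigma l a}.
  move=> _ /sumsetP[_ /sumsetP[x xA [y yB ->]] [_ /CE[s [ss cs ->]] ->]].
  have -> : x + y + \sum_(x <- s) x = \sum_(x <- [:: x, y & s]) x.
    by rewrite !big_cons addrA.
  apply: mem_Sigma => [|z]; first by rewrite /= ss ek.
  have /(_ (pred1 z)) -> := permP pa; rewrite count_cat.
  have /(_ (pred1 z)) -> := permP pa'; rewrite count_cat /=.
  rewrite !leq_add // count_uniq_mem ?undup_uniq ?fset_uniq //.
    by case: eqP => // <-; rewrite -AFE xA.
  by case: eqP => // <-; rewrite yB.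
have leS : (#|` sumset (sumset AF B) C| <= N)%N by apply: uniq_leq_size.
have A2 : (1 < #|` AF|)%N.
  rewrite cardAF; apply: leq_trans X2 _; apply: uniq_leq_size => // x.
  by rewrite mem_filter => /andP[].
have AF0 : AF != fset0 by rewrite -cardfs_gt0 ltnW.
have B0 : B != fset0 by rewrite -cardfs_gt0 ltnW.
have AB0 := sumset_neq0 AF0 B0.
have leC : (#|` C| <= N)%N.
  by apply: leq_trans leS; rewrite sumsetC card_sumset_ge.
have leAB : (#|` sumset AF B| <= N)%N.
  by apply: leq_trans leS; rewrite card_sumset_ge.
have {}cardC := cardC leC.
have cd := cauchy_davenport hN AB0 C0 leS.
suff [c [d [r [d0 h]]]] : exists c d r, d != 0 /\
    forall x, x \in AF <-> exists j, (j < r)%N /\ x = c + d *+ j.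
  by exists c, d, r; split=> // x; rewrite -AFE.
have leAF : (#|` AF| <= N)%N by apply: leq_trans leAB; rewrite card_sumset_ge.
have [eB|nB] := eqVneq (#|` B|) 2%N.
  by apply: (AP_of_pair hN AF0 eB leAF); lia.
(* Add [cd] and [cardC], then eliminate [N] by [eN]. *)
have ltAB : (#|` sumset AF B| < #|` AF| + #|` B|)%N by lia.
(* For [k = 0], that is [l = 2], the stronger hypothesis allows [N.+1] as the bound. Otherwise [cB]
   gives [2 * k] remaining terms, so [C] has at least [k.+1 >= 2] elements and [cd] makes [A + B]
   smaller than [N]. *)
have [k0|k0] := posnP k.
  move: hp; rewrite {1}ek k0 eqxx => hp.
  by apply: (vosper hp A2 B2) => //; lia.
apply: (vosper hN A2 B2) => //; lia.
Qed.
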